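(* Let $a=[a_0;a_1,\dots,a_{2\ell-1}]$ be the even-length continued fraction expansion of a positive rational number. The set of admissible sequences for $a$ satisfies \[ \left(\begin{array}{r} \sum_{b\in \mathcal{B}^\bullet(a)} q^{\Vert b\Vert_1}\\ \sum_{b\in \mathcal{B}^\circ(a)} q^{\Vert b\Vert_1} \end{array}\right) = \left(\begin{smallmatrix} 1 & 0 \\ 0 & q \end{smallmatrix}\right)^{-1} R_q^{a_0}L_q^{a_1}\cdots R_q^{a_{2\ell-2}}L_q^{a_{2\ell-1}} \left(\begin{smallmatrix} 1 \\ 0 \end{smallmatrix}\right), \] where $\Vert b\Vert_1=b_0+b_1+\dots+b_{2\ell-1}$ for every admissible sequence $(b_i)_{0\le i<2\ell}\in\mathcal{B}(a)$.
   Context: Here $q$ is an indeterminate, $a_0\ge 0$ and $a_i\ge1$ for $1\le i<2\ell$, and $L_q=\left(\begin{smallmatrix} q & 0\\ q & 1\end{smallmatrix}\right)$, $R_q=\left(\begin{smallmatrix} q & 1\\ 0 & 1\end{smallmatrix}\right)$. A finite sequence of integers $(b_i)_{0\le i<k}$ is admissible for $a=[a_0;\dots,a_{k-1}]$ if: $0\le b_i\le a_i$ for all $i$; if $i>0$ is odd and $b_i=a_i$ then $b_{i-1}=a_{i-1}$; if $i>0$ is even and $b_i=0$ then $b_{i-1}=0$. $\mathcal{B}(a)$ is the set of admissible sequences for $a$, split as the disjoint union of $\mathcal{B}^\bullet(a)=\{b\in\mathcal{B}(a)\mid b_0=a_0=0<b_1=a_1 \text{ or } 0<b_0\}$ and $\mathcal{B}^\circ(a)=\{b\in\mathcal{B}(a)\mid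 b_0=a_0=0\le b_1<a_1 \text{ or } 0=b_0<a_0\}$. *)

(* Defs.v *)
From mathcomp Require Import all_boot all_order all_algebra.

Set Implicit Arguments.
Unset Strict Implicit.
Unset Printing Implicit Defensive.

Import GRing.Theory.
Local Open Scope ring_scope.

(* The empty sequence is only a base case: since 0^-1 = 0 in rat, one gets
   cf_val [:: n] = n. *)
Fixpoint cf_val (a : seq nat) : rat :=
  if a is n :: a' then n%:R + (cf_val a')^-1 else 0.

(* a = [a_0; a_1, ..., a_(2l-1)]; a_0 >= 0 is enforced by the type. *)
Definition even_cf (x : rat) (l : nat) (a : seq nat) : Prop :=
  [/\ (0 < l)%N,
      size a = (2 * l)%N,
      forall i : nat, (1 <= i < 2 * l)%N -> (1 <= nth 0%N a i)%N
    & cf_val a = x].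

(* The bounds 0 <= b_i make natural numbers the right type for the entries. *)
Definition admissible (a b : seq nat) : bool :=
  (size b == size a) &&
  [forall i : 'I_(size a),
    [&& (nth 0 b i <= nth 0 a i)%N,
        [&& 0 < i, odd i & nth 0 b i == nth 0 a i]%N
          ==> (nth 0 b i.-1 == nth 0 a i.-1)%N
      & [&& 0 < i, ~~ odd i & nth 0 b i == 0]%N
          ==> (nth 0 b i.-1 == 0)%N]].

(* A finite type large enough to contain every admissible sequence for a
   exactly once (see adm_setP and bseq_inj); its elements are read as sequences through bseq. *)
Definition bounded_seq (a : seq nat) :=
  (size a).-tuple 'I_(\max_(m <- a) m).+1.

Definition bseq (a : seq nat) (b : bounded_seq a) : seq nat :=
  [seq val m | m <- val b].

Definition adm_set (a : seq nat) : {set bounded_seq a} :=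
  [set b : bounded_seq a | admissible a (bseq b)].

Definition is_bullet (a b : seq nat) : bool :=
  [&& nth 0 b 0 == nth 0 a 0, nth 0 a 0 == 0,
      0 < nth 0 b 1 & nth 0 b 1 == nth 0 a 1]%N
  || (0 < nth 0 b 0)%N.

Definition is_circ (a b : seq nat) : bool :=
  [&& nth 0 b 0 == nth 0 a 0, nth 0 a 0 == 0,
      0 <= nth 0 b 1 & nth 0 b 1 < nth 0 a 1]%N
  || ((nth 0 b 0 == 0) && (nth 0 b 0 < nth 0 a 0))%N.

Definition adm_bullet (a : seq nat) : {set bounded_seq a} :=
  [set b in adm_set a | is_bullet a (bseq b)].

Definition adm_circ (a : seq nat) : {set bounded_seq a} :=
  [set b in adm_set a | is_circ a (bseq b)].

Definition norm1 (a : seq nat) (b : bounded_seq a) : nat := sumn (bseq b).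

Lemma adm_setP (a s : seq nat) :
  reflect (exists2 b : bounded_seq a, b \in adm_set a & bseq b = s)
          (admissible a s).
Proof.
apply: (iffP idP) => [adm_s | [b]]; last by rewrite inE => adm_b <-.
case/andP: (adm_s) => /eqP sz_s /forallP le_s.
have size_b : size [seq (inord m : 'I_(\max_(m <- a) m).+1) | m <- s]
              == size a by rewrite size_map sz_s.
have Db : bseq (Tuple size_b : bounded_seq a) = s.
  rewrite /bseq /= -map_comp -[RHS]map_id.
  apply/eq_in_map => m /(nthP 0%N)[i lt_i <-] /=.
  rewrite inordK // ltnS; rewrite sz_s in lt_i.
  have /and3P[le_i _ _] := le_s (Ordinal lt_i).
  by apply: leq_trans le_i _; apply: leq_bigmax_seq => //; apply: mem_nth.
by exists (Tuple size_b); rewrite ?inE Db.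
Qed.

Lemma bseq_inj (a : seq nat) : injective (@bseq a).
Proof. by move=> b c /(inj_map val_inj) /val_inj. Qed.

(* The field Q(q), as the fraction field of Z[q]. *)
Definition Qq : fieldType := {fraction {poly int}}.

Definition q : Qq := tofrac 'X.

Definition mx22 (x y z t : Qq) : 'M[Qq]_2 :=
  \matrix_(i, j) nth 0 (nth [::] [:: [:: x; y]; [:: z; t]] i) j.

Definition col2 (x y : Qq) : 'cV[Qq]_2 := \col_i nth 0 [:: x; y] i.

Definition Lq : 'M[Qq]_2 := mx22 q 0
                                 q 1.

Definition Rq : 'M[Qq]_2 := mx22 q 1
                                 0 1.

(* Main.v *)
(* Peel off the first two entries n0, n1 of a.  The tail of an admissible
   sequence is admissible, and only the vanishing of the head of the tail
   constrains the entries m0, m1 in front of it: if that head is 0 then m1 = 0.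
   Hence, with F+ and F0 the generating functions of the tails with nonzero and
   zero head, the bullet and circ sums for a are
     q^(n0+n1) F+ + q [n0] ([n1] F+ + F0)  and  [n1] F+ + F0,
   which says that (bullet, q circ) = Rq^n0 Lq^n1 (F+, q F0).  When n0 > 0,
   bullet and circ mean nonzero and zero head, so the recursion iterates; the
   empty tail imposes no constraint and so counts as having nonzero head. *)

Require Import Defs.
From mathcomp Require Import all_boot all_order all_algebra.
From mathcomp Require Import ring.
Import GRing.Theory Num.Theory.
Local Open Scope ring_scope.

(** * Powers of [Rq] and [Lq] acting on columns *)

Lemma col2M (x y z t u v : Qq) :
  mx22 x y z t *m col2 u v = col2 (x * u + y * v) (z * u + t * v).
Proof.
apply/matrixP => i j; rewrite !mxE !big_ord_recl big_ord0 addr0 !mxE /=.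
by case: i => [[|[|i]] //= lt_i]; rewrite /= ?addr0.
Qed.

(** The q-integer, written [n] below. *)
Definition qnum (n : nat) : Qq := \sum_(0 <= i < n) q ^+ i.

Lemma qnumS n : qnum n.+1 = qnum n + q ^+ n.
Proof. by rewrite /qnum big_nat_recr. Qed.

Lemma RqX_col2 n (u v : Qq) :
  Rq ^+ n *m col2 u v = col2 (q ^+ n * u + qnum n * v) v.
Proof.
elim: n u v => [|n IHn] u v.
  by rewrite expr0 mul1mx /qnum big_geq // mul0r addr0 mul1r.
(* [Rq] is peeled off on the right here, [Lq] on the left below, so that both inductions use [n+1] =
   [n] + q^n. *)
by rewrite exprSr -mulmxE -mulmxA col2M IHn qnumS exprSr; congr col2; ring.
Qed.

Lemma LqX_col2 n (u v : Qq) :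
  Lq ^+ n *m col2 u v = col2 (q ^+ n * u) (q * qnum n * u + v).
Proof.
elim: n u v => [|n IHn] u v.
  by rewrite expr0 mul1mx /qnum big_geq // mulr0 mul0r add0r mul1r.
rewrite exprS -mulmxE -mulmxA IHn col2M qnumS exprS.
by congr col2; ring.
Qed.

(** * Listing admissible sequences and peeling two entries *)

(** Built by recursion on [a] so that a sum over it splits along the first entry; the type
    [bounded_seq a] depends on all of [a] through its maximum. *)
Fixpoint boxes (a : seq nat) : seq (seq nat) :=
  if a is n :: a' then [seq m :: s | m <- iota 0 n.+1, s <- boxes a']
  else [:: [::]].

Lemma boxes_cons n a :
  boxes (n :: a) = [seq m :: s | m <- index_iota 0 n.+1, s <- boxes a].
Proof. by []. Qed.

Lemma boxes_uniq a : uniq (boxes a).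
Proof.
elim: a => //= n a IHa; apply: (@allpairs_uniq _ _ _ _ (iota 0 n.+1)) => //.
  exact: iota_uniq.
by move=> [m s] [m' s'] _ _ /= [-> ->].
Qed.

Lemma mem_boxes (a s : seq nat) :
    size s = size a ->
    (forall i, (i < size a)%N -> (nth 0 s i <= nth 0 a i)%N) ->
  s \in boxes a.
Proof.
elim: a s => [|n a IHa] [|m s] //= [sz_s] le_s.
apply: (@allpairs_f _ _ _ cons (iota 0 n.+1)).
  by rewrite mem_iota /= add0n ltnS (le_s 0%N).
by apply: IHa => // i lt_i; apply: (le_s i.+1).
Qed.

Definition adm_at (a b : seq nat) (i : nat) : bool :=
  [&& (nth 0 b i <= nth 0 a i)%N,
      [&& 0 < i, odd i & nth 0 b i == nth 0 a i]%N
        ==> (nth 0 b i.-1 == nth 0 a i.-1)%N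
    & [&& 0 < i, ~~ odd i & nth 0 b i == 0]%N
        ==> (nth 0 b i.-1 == 0)%N].

Lemma admissibleP (a b : seq nat) :
  reflect (size b = size a /\ forall i, (i < size a)%N -> adm_at a b i)
          (admissible a b).
Proof.
apply: (iffP andP) => [[/eqP sz_b /forallP adm_b] | [sz_b adm_b]].
  by split=> // i lt_i; apply: (adm_b (Ordinal lt_i)).
by split; [apply/eqP | apply/forallP => i; apply: adm_b].
Qed.

Lemma admissible_boxes (a s : seq nat) : admissible a s -> s \in boxes a.
Proof.
by case/admissibleP=> sz_s adm_s; apply: mem_boxes => // i /adm_s/and3P[].
Qed.

(* The default value 1 of head makes the condition vacuous when b is empty. *)
Lemma admissible_cons2 (n0 n1 : nat) (a : seq nat) (m0 m1 : nat) (b : seq nat) :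
  admissible [:: n0, n1 & a] [:: m0, m1 & b]
  = [&& m0 <= n0, m1 <= n1, (m1 == n1) ==> (m0 == n0),
        (head 1 b == 0) ==> (m1 == 0) & admissible a b]%N.
Proof.
apply/admissibleP/and5P => [[[sz_b] adm_b] | [le0 le1 top1 bot2]].
  have := adm_b 0%N isT; have := adm_b 1%N isT.
  rewrite /adm_at /= !andbT => /andP[-> top1] ->; split=> //.
    case: a b sz_b adm_b => [|n2 a] [|m2 b] //= _ /(_ 2%N isT).
    by rewrite /adm_at /= => /andP[].
  apply/admissibleP; split=> // i lt_i.
  (* A shift by two preserves parity, so the condition at [i.+2] is that of the tail at [i], except
     that at [i = 0] the tail asks only for the bound. *)
  have := adm_b i.+2 lt_i; rewrite /adm_at /= negbK.
  by case: i lt_i => [|i] //= _ /andP[->].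
case/admissibleP=> sz_b adm_b; split=> [|[|[|i]] /= lt_i]; first by rewrite /= sz_b.
- by rewrite /adm_at /= le0.
- by rewrite /adm_at /= le1 top1.
have := adm_b i lt_i; rewrite /adm_at /= negbK.
case: i lt_i => [|i] //= lt_i /andP[-> _] /=.
by case: b sz_b bot2 {adm_b} => [|m2 b] //= sz_b; case: a lt_i sz_b.
Qed.

(** * Generating functions of admissible sequences *)

Definition adm_gf (a : seq nat) (P : pred (seq nat)) : Qq :=
  \sum_(s <- boxes a | admissible a s && P s) q ^+ sumn s.

(** Both index lists, once filtered, are duplicate-free with the same members, hence permutations of
    each other. *)
Lemma adm_gfE (a : seq nat) (P : pred (seq nat)) :
  \sum_(b in [set b in adm_set a | P (Defs.bseq b)]) q ^+ norm1 b = adm_gf a P.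
Proof.
transitivity (\sum_(s <- map (@Defs.bseq a) (enum {: bounded_seq a})
                 | admissible a s && P s) q ^+ sumn s).
  by rewrite big_map big_enum_cond; apply: eq_bigl => b; rewrite !inE.
rewrite /adm_gf -[LHS]big_filter -[RHS]big_filter; apply: perm_big.
apply: uniq_perm.
- by rewrite filter_uniq // map_inj_uniq ?enum_uniq //; apply: Defs.bseq_inj.
- by rewrite filter_uniq ?boxes_uniq.
move=> s; rewrite !mem_filter; case: (boolP (admissible a s)) => //= adm_s.
rewrite admissible_boxes //; case/adm_setP: adm_s => b _ <-.
by rewrite map_f ?mem_enum.
Qed.

(** F+ and F0 of the overview; the default 1 puts the empty tail into F+. *)
Definition gf_pos (a : seq nat) : Qq := adm_gf a (fun s => head 1 s != 0)%N.
Definition gf_zero (a : seq nat) : Qq := adm_gf a (fun s => head 1 s == 0)%N.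

(** For fixed [m0], [m1] the tails are split by their head: a nonzero head is always allowed, a zero
    head only when [m1 = 0]. *)
Lemma adm_gf_cons2 (n0 n1 : nat) (a : seq nat) (P : pred (seq nat))
    (Q : nat -> nat -> bool) :
    (forall m0 m1 s, P [:: m0, m1 & s] = Q m0 m1) ->
  adm_gf [:: n0, n1 & a] P
  = \sum_(0 <= m0 < n0.+1) \sum_(0 <= m1 < n1.+1)
      (if ((m1 == n1) ==> (m0 == n0)) && Q m0 m1
       then q ^+ m0 * (q ^+ m1 * (gf_pos a + (if m1 == 0%N then gf_zero a else 0)))
       else 0).
Proof.
move=> PQ; rewrite /adm_gf boxes_cons big_mkcond big_allpairs_dep.
apply: eq_big_nat => m0; rewrite ltnS => /andP[_ le0].
rewrite boxes_cons big_allpairs_dep.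
apply: eq_big_nat => m1; rewrite ltnS => /andP[_ le1].
under eq_bigr => s _ do rewrite admissible_cons2 le0 le1 PQ /=.
rewrite -big_mkcond /=.
case: ifP => [/andP[-> ->]|nQ]; last first.
  by rewrite big1 // => s /andP[/and3P[top1 _ _] Qm]; rewrite top1 Qm in nQ.
rewrite (bigID (fun s => head 1 s == 0)%N) /= addrC mulrA mulrDr; congr (_ + _).
  rewrite /gf_pos /adm_gf big_distrr /=; apply: eq_big => s; last first.
    by rewrite !exprD mulrA.
  by case: (head 1 s == 0)%N; rewrite /= ?andbF ?andbT.
rewrite /gf_zero /adm_gf; case: ifP => m1_0; last first.
  by rewrite mulr0 big1 // => s; case: (head 1 s == 0)%N; rewrite /= ?andbF.
rewrite big_distrr /=; apply: eq_big => s; last by rewrite !exprD mulrA.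
by case: (head 1 s == 0)%N; rewrite /= ?andbF ?andbT.
Qed.

(** * Summation over the first two entries *)

Section Step.
Variables (n0 n1 : nat) (a : seq nat).
Hypothesis n1_gt0 : (0 < n1)%N.

Let below_top (m0 : nat) : Qq := q ^+ m0 * (qnum n1 * gf_pos a + gf_zero a).

Lemma sum_below_top (m0 : nat) :
  \sum_(0 <= m1 < n1)
     q ^+ m0 * (q ^+ m1 * (gf_pos a + (if m1 == 0%N then gf_zero a else 0)))
  = below_top m0.
Proof.
rewrite /below_top -big_distrr /=; congr (_ * _).
under eq_bigr => m1 _ do rewrite mulrDr.
rewrite big_split /= -big_distrl /= -/(qnum n1); congr (_ + _).
case: (n1) n1_gt0 => // n _; rewrite big_nat_recl //= mul1r big1 ?addr0 // => i _.
by rewrite mulr0.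
Qed.

(** For [m1 < n1] the top condition is vacuous. The term [m1 = n1] forces [m0 = n0] and, as
    [n1 > 0], excludes tails with zero head. *)
Lemma sum_row (Q : pred nat) (m0 : nat) :
  \sum_(0 <= m1 < n1.+1)
      (if ((m1 == n1) ==> (m0 == n0)) && Q m1
       then q ^+ m0 * (q ^+ m1 * (gf_pos a + (if m1 == 0%N then gf_zero a else 0)))
       else 0)
  = \sum_(0 <= m1 < n1)
      (if Q m1
       then q ^+ m0 * (q ^+ m1 * (gf_pos a + (if m1 == 0%N then gf_zero a else 0)))
       else 0)
    + (if (m0 == n0) && Q n1 then q ^+ (n0 + n1) * gf_pos a else 0).
Proof.
rewrite big_nat_recr //=; congr (_ + _).
  by apply: eq_big_nat => m1 /andP[_ lt1]; rewrite ltn_eqF.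
rewrite eqxx /= (gtn_eqF n1_gt0) addr0.
by case: ifP => // /andP[/eqP-> _]; rewrite exprD mulrA.
Qed.

(** For [n0 = 0] only [m1 = n1] is bullet, and [qnum 0 = 0] kills the second summand. For [n0 > 0]
    the rows [m0 = 1, ..., n0] contribute, the last one with the extra term at [m1 = n1]. *)
Lemma adm_gf_bullet :
  adm_gf [:: n0, n1 & a] (is_bullet [:: n0, n1 & a])
  = q ^+ (n0 + n1) * gf_pos a
    + q * qnum n0 * (qnum n1 * gf_pos a + gf_zero a).
Proof.
rewrite (@adm_gf_cons2 _ _ _ _
  (fun m0 m1 => [&& m0 == n0, n0 == 0, 0 < m1 & m1 == n1] || (0 < m0))%N) //.
under eq_bigr => m0 _ do rewrite sum_row.
case: n0 => [|n].
  rewrite big_nat1 /= n1_gt0 eqxx /= /qnum [X in _ * X * _]big_geq //.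
  rewrite mulr0 mul0r addr0 big1_seq ?add0r // => m1 /=.
  by rewrite mem_index_iota => /andP[_ lt1]; rewrite orbF ltn_eqF ?andbF.
rewrite big_split /= addrC; congr (_ + _).
  rewrite big_nat_recr //= eqxx orbT big1_seq ?add0r // => m0 /=.
  by rewrite mem_index_iota => /andP[_ lt0]; rewrite ltn_eqF.
rewrite big_nat_recl //= big1 ?add0r //.
under eq_bigr => m0 _ do (under eq_bigr => m1 _ do rewrite orbT); rewrite /=.
under eq_bigr => m0 _ do rewrite sum_below_top /below_top exprS.
by rewrite -big_distrl /= -big_distrr.
Qed.

(** In both cases exactly [m0 = 0], [m1 < n1] remains: by definition if [n0 = 0], and otherwise
    because [m1 = n1] would force [m0 = n0 > 0]. *)
Lemma adm_gf_circ :
  adm_gf [:: n0, n1 & a] (is_circ [:: n0, n1 & a])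
  = qnum n1 * gf_pos a + gf_zero a.
Proof.
rewrite (@adm_gf_cons2 _ _ _ _
  (fun m0 m1 => [&& m0 == n0, n0 == 0, 0 <= m1 & m1 < n1]
                || (m0 == 0) && (m0 < n0))%N) //.
under eq_bigr => m0 _ do rewrite sum_row.
rewrite -[RHS]mul1r -[1]/(q ^+ 0) -/(below_top 0) -sum_below_top.
case: n0 => [|n].
  rewrite big_nat1 !ltnn !andbF addr0.
  by apply: eq_big_nat => m1 /andP[_ ->]; rewrite leq0n eqxx.
rewrite big_nat_recl //= [X in _ + X]big1 ?addr0 // => m0 _.
by rewrite !andbF /= addr0 big1.
Qed.

End Step.

(** * Iterating the recursion *)

Lemma gf_pos_nil : gf_pos [::] = 1.
Proof.
rewrite /gf_pos /adm_gf /= big_mkcond big_seq1 /=.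
by have -> : admissible [::] [::] by apply/admissibleP.
Qed.

Lemma gf_zero_nil : gf_zero [::] = 0.
Proof. by rewrite /gf_zero /adm_gf /= big_mkcond big_seq1 /= andbF. Qed.

(** The empty sequence has the wrong size for [n :: a], so the values of [P] and [Q] there are
    irrelevant. *)
Lemma adm_gf_eq (n : nat) (a : seq nat) (P Q : pred (seq nat)) :
    (forall m s, P (m :: s) = Q (m :: s)) ->
  adm_gf (n :: a) P = adm_gf (n :: a) Q.
Proof.
move=> PQ; apply: eq_bigl => -[|m s]; last by rewrite PQ.
by rewrite /admissible.
Qed.

Lemma gf_posE (n : nat) (a : seq nat) :
  (0 < n)%N -> gf_pos (n :: a) = adm_gf (n :: a) (is_bullet (n :: a)).
Proof.
move=> n_gt0; apply: adm_gf_eq => m s.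
by rewrite /is_bullet /= (gtn_eqF n_gt0) andbF /= lt0n.
Qed.

Lemma gf_zeroE (n : nat) (a : seq nat) :
  (0 < n)%N -> gf_zero (n :: a) = adm_gf (n :: a) (is_circ (n :: a)).
Proof.
move=> n_gt0; apply: adm_gf_eq => m s.
rewrite /is_circ /= (gtn_eqF n_gt0) andbF /=.
by case: eqP => [->|].
Qed.

Definition cf_mx (l : nat) (a : seq nat) : 'M[Qq]_2 :=
  \prod_(i < l) (Rq ^+ nth 0%N a (2 * i) * Lq ^+ nth 0%N a (2 * i).+1).

Lemma cf_mx_cons2 (l n0 n1 : nat) (a : seq nat) :
  cf_mx l.+1 [:: n0, n1 & a] = Rq ^+ n0 * Lq ^+ n1 * cf_mx l a.
Proof.
rewrite /cf_mx big_ord_recl muln0; congr (_ * _).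
by apply: eq_bigr => i _; rewrite lift0 mulnS.
Qed.

Lemma adm_gf_col2 (n0 n1 : nat) (a : seq nat) :
    (0 < n1)%N ->
  col2 (adm_gf [:: n0, n1 & a] (is_bullet [:: n0, n1 & a]))
       (q * adm_gf [:: n0, n1 & a] (is_circ [:: n0, n1 & a]))
  = Rq ^+ n0 * Lq ^+ n1 *m col2 (gf_pos a) (q * gf_zero a).
Proof.
move=> n1_gt0; rewrite -mulmxE -mulmxA LqX_col2 RqX_col2.
by rewrite adm_gf_bullet // adm_gf_circ // exprD; congr col2; ring.
Qed.

(** Positivity of every entry, the first included, identifies nonzero and zero head with bullet and
    circ at each stage of the induction. *)
Lemma gf_pos_zero_col2 (l : nat) (a : seq nat) :
    size a = (2 * l)%N -> all (leq 1) a ->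
  col2 (gf_pos a) (q * gf_zero a) = cf_mx l a *m col2 1 0.
Proof.
elim: l a => [|l IHl] a.
  rewrite muln0 => /size0nil-> _.
  by rewrite gf_pos_nil gf_zero_nil mulr0 /cf_mx big_ord0 mul1mx.
case: a => [|n0 [|n1 a]] //; rewrite mulnS // => -[sz_a] /and3P[n0_gt0 n1_gt0 a_gt0].
rewrite gf_posE // gf_zeroE // adm_gf_col2 // IHl // cf_mx_cons2.
by rewrite -mulmxE mulmxA.
Qed.

Lemma q_neq0 : q != 0.
Proof. by rewrite tofrac_eq0 polyX_eq0. Qed.

Theorem theoremB (x : rat) (l : nat) (a : seq nat)
    (x_gt0 : 0 < x) (a_cf : even_cf x l a) :
  col2 (\sum_(b in adm_bullet a) q ^+ norm1 b)
       (\sum_(b in adm_circ a) q ^+ norm1 b)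
  = invmx (mx22 1 0
                0 q)
    *m (\prod_(i < l) (Rq ^+ nth 0%N a (2 * i) * Lq ^+ nth 0%N a (2 * i).+1))
    *m col2 1 0.
Proof.
case: a_cf => l_gt0 sz_a a_gt0 _.
rewrite -/(cf_mx l a) -mulmxA !adm_gfE.
case: l l_gt0 sz_a a_gt0 => // l _; rewrite mulnS.
case: a => [|n0 [|n1 a]] // [sz_a] a_gt0.
have n1_gt0 : (0 < n1)%N by apply: (a_gt0 1%N).
(* Since [n0] may vanish, the first two entries are treated by [adm_gf_col2] and only the tail by
   the induction. *)
have all_gt0 : all (leq 1) a.
  by apply/(all_nthP 0%N) => i; rewrite sz_a => lt_i; apply: (a_gt0 i.+2).
rewrite cf_mx_cons2 -mulmxE -[X in invmx _ *m X]mulmxA.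
rewrite -gf_pos_zero_col2 // -adm_gf_col2 //.
(* The factor [q] on the circ sum is the diagonal matrix that the inverse cancels. *)
have mulD u v : col2 u (q * v) = mx22 1 0 0 q *m col2 u v.
  by rewrite col2M; congr col2; ring.
rewrite mulD mulKmx // unitmxE det_trig.
  by rewrite !big_ord_recl big_ord0 !mxE /= mul1r mulr1 unitfE q_neq0.
by apply/is_trig_mxP => -[[|[|i]] //= lt_i] [[|[|j]] //= lt_j]; rewrite mxE.
Qed.
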